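(* Let $\mathcal{V}$ be one of the categories $\mathbf{Pos}$, $\mathbf{CPO}$ or $\mathbf{DCPO}$. The strongly finitary endofunctors of $\mathcal{V}$ are precisely the ($\mathcal{V}$-enriched) endofunctors preserving directed colimits and reflexive, surjective coinserters.
   Context: $\mathbf{Pos}$: posets and monotone maps. $\mathbf{CPO}$: posets with joins of $\omega$-chains, and continuous maps (monotone maps preserving joins of $\omega$-chains). $\mathbf{DCPO}$: posets with directed joins, and $\Delta$-continuous maps (monotone maps preserving directed joins). All three are cartesian closed with $[A,B]$ the set of morphisms ordered pointwise, and endofunctors are enriched over the given category: locally monotone, locally continuous, locally $\Delta$-continuous, respectively. $K:\mathbf{Set}_{fin}\to\mathcal{V}$ is the full embedding of finite sets as finite discrete posets. An enriched endofunctor $T$ of $\mathcal{V}$ is strongly finitary if $T=\mathrm{Lan}_K(T\circ K)$ (enriched left Kan extension). A coinserter of an ordered parallel pair $f_0,f_1:A\to B$ in $\mathcal{V}$ is a morphism $c:B\to C$ with $cf_0\sqsubseteq cf_1$ such that every $c'$ with $c'f_0\sqsubseteq c'f_1$ factorizes through $c$, and $uc\sqsubseteq vc$ implies $u\sqsubseteq v$ for all $u,v$ with domain $C$. It is reflexive if there is $\delta:B\to A$ with $f_0\delta=f_1\delta=\mathrm{id}_B$; it is surjective if $c$ is a surjective map. *)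

(* Defs.v *)
From Stdlib Require Import Relation_Definitions List FinFun.
From Stdlib Require Import FunctionalExtensionality ProofIrrelevance ClassicalEpsilon.

Set Implicit Arguments.
Unset Strict Implicit.
Unset Printing Implicit Defensive.

(** * Posets and joins *)

Record Poset : Type := {
  carrier :> Type;
  le : relation carrier;
  le_order : order carrier le }.

Notation "x ⊑ y" := (le x y) (at level 70, no associativity).

Section Joins.
Variable X : Poset.
Implicit Type S : X -> Prop.

Definition is_join S (s : X) : Prop :=
  (forall x, S x -> x ⊑ s) /\ (forall y, (forall x, S x -> x ⊑ y) -> s ⊑ y).

Definition is_omega_chain S : Prop :=
  exists u : nat -> X,
    (forall n, u n ⊑ u (Datatypes.S n)) /\ (forall x, S x <-> exists n, x = u n).

(* Directed sets are nonempty: no bottom element is assumed in DCPO. *)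
Definition is_directed S : Prop :=
  (exists x, S x) /\
  (forall x y, S x -> S y -> exists z, S z /\ x ⊑ z /\ y ⊑ z).

End Joins.

Definition image (A B : Type) (f : A -> B) (S : A -> Prop) : B -> Prop :=
  fun y => exists x, S x /\ y = f x.

Definition monotone (X Y : Poset) (f : X -> Y) : Prop :=
  forall x y, x ⊑ y -> f x ⊑ f y.

(** * The three base categories *)

Inductive base : Type := Pos | CPO | DCPO.

(* The subsets whose joins exist in the objects and are preserved by the
   morphisms: none for Pos, the omega-chains for CPO, the directed subsets
   for DCPO. *)
Definition admissible (V : base) (X : Poset) (S : X -> Prop) : Prop :=
  match V with
  | Pos => False
  | CPO => is_omega_chain S
  | DCPO => is_directed S
  end.

Record Obj (V : base) : Type := {
  poset :> Poset;
  has_joins : forall S : poset -> Prop, admissible V S -> exists s, is_join S s }.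

Definition continuous (V : base) (X Y : Poset) (f : X -> Y) : Prop :=
  monotone f /\
  (forall (S : X -> Prop) (s : X),
     admissible V S -> is_join S s -> is_join (image f S) (f s)).

Record Hom (V : base) (X Y : Obj V) : Type := {
  fn :> X -> Y;
  fn_continuous : continuous V fn }.

Section OrderFacts.
Variable X : Poset.

Lemma le_refl (x : X) : x ⊑ x.
Proof. exact (ord_refl _ _ (le_order X) x). Qed.

Lemma le_trans (x y z : X) : x ⊑ y -> y ⊑ z -> x ⊑ z.
Proof. exact (ord_trans _ _ (le_order X) x y z). Qed.

Lemma le_antisym (x y : X) : x ⊑ y -> y ⊑ x -> x = y.
Proof. exact (ord_antisym _ _ (le_order X) x y). Qed.

Lemma join_unique (S : X -> Prop) s t : is_join S s -> is_join S t -> s = t.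
Proof.
intros [Hs Ls] [Ht Lt]; apply le_antisym; [apply Ls | apply Lt]; assumption.
Qed.

End OrderFacts.

Lemma admissible_image (V : base) (X Y : Poset) (f : X -> Y) (S : X -> Prop) :
  monotone f -> admissible V S -> admissible V (image f S).
Proof.
intros Hf; destruct V; simpl.
- tauto.
- intros [u [Hu HS]]; exists (fun n => f (u n)); split.
  + intros n; apply Hf, Hu.
  + intros y; split.
    * intros [x [Hx ->]]; apply HS in Hx; destruct Hx as [n ->]; now exists n.
    * intros [n ->]; exists (u n); split; auto; apply HS; now exists n.
- intros [[x Hx] Hd]; split.
  + exists (f x); now exists x.
  + intros y1 y2 [x1 [H1 ->]] [x2 [H2 ->]].
    destruct (Hd x1 x2 H1 H2) as [z [Hz [Hz1 Hz2]]].
    exists (f z); split; [now exists z | split; apply Hf; assumption].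
Qed.

Lemma hom_ext (V : base) (X Y : Obj V) (f g : Hom X Y) :
  (forall x, f x = g x) -> f = g.
Proof.
destruct f as [f Hf], g as [g Hg]; simpl; intros H.
apply functional_extensionality in H; subst g.
now rewrite (proof_irrelevance _ Hf Hg).
Qed.

(** * Identity, composition and internal homs of V *)

Lemma continuous_id (V : base) (X : Poset) : continuous V (fun x : X => x).
Proof.
split; [now intros x y H |].
intros S s _ [Hu Hl]; split.
- intros y [x [Hx ->]]; auto.
- intros y Hy; apply Hl; intros x Hx; apply Hy; now exists x.
Qed.

Definition hom_id (V : base) (X : Obj V) : Hom X X :=
  {| fn := fun x => x; fn_continuous := continuous_id V X |}.

Lemma continuous_comp (V : base) (X Y Z : Poset) (g : Y -> Z) (f : X -> Y) :
  continuous V g -> continuous V f -> continuous V (fun x => g (f x)).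
Proof.
intros [Mg Jg] [Mf Jf]; split.
- intros x y H; apply Mg, Mf, H.
- intros S s HS Hs.
  destruct (Jg _ _ (admissible_image Mf HS) (Jf _ _ HS Hs)) as [Hu Hl]; split.
  + intros z [x [Hx ->]]; apply Hu; exists (f x); split; auto; now exists x.
  + intros z Hz; apply Hl; intros w [y [[x [Hx ->]] ->]].
    apply Hz; now exists x.
Qed.

Definition hom_comp (V : base) (X Y Z : Obj V) (g : Hom Y Z) (f : Hom X Y) :
    Hom X Z :=
  {| fn := fun x => g (f x);
     fn_continuous := continuous_comp (fn_continuous g) (fn_continuous f) |}.

Definition hom_le (V : base) (X Y : Obj V) : relation (Hom X Y) :=
  fun f g => forall x, f x ⊑ g x.

Lemma hom_le_order (V : base) (X Y : Obj V) : order (Hom X Y) (@hom_le V X Y).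
Proof.
split.
- intros f x; apply le_refl.
- intros f g h H1 H2 x; eapply le_trans; [apply H1 | apply H2].
- intros f g H1 H2; apply hom_ext; intros x; now apply le_antisym.
Qed.

Definition hom_poset (V : base) (X Y : Obj V) : Poset :=
  {| carrier := Hom X Y; le := @hom_le V X Y; le_order := hom_le_order X Y |}.

Section HomJoins.
Variables (V : base) (X Y : Obj V).

Definition eval (x : X) : hom_poset X Y -> Y := fun f => fn f x.

Lemma eval_monotone x : monotone (eval x).
Proof. intros f g H; apply H. Qed.

Lemma pointwise_join (S : hom_poset X Y -> Prop) (s : hom_poset X Y) :
  (forall x, is_join (image (eval x) S) (eval x s)) -> is_join S s.
Proof.
intros H; split.
- intros f Hf x; apply (proj1 (H x)); now exists f.
- intros g Hg x; apply (proj2 (H x)).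
  intros y [f [Hf ->]]; exact (Hg f Hf x).
Qed.

Lemma pointwise_join_exists (S : hom_poset X Y -> Prop) :
  admissible V S ->
  exists s : hom_poset X Y, forall x, is_join (image (eval x) S) (eval x s).
Proof.
intros HS.
assert (E : forall x, {y | is_join (image (eval x) S) y}).
{ intros x; apply constructive_indefinite_description, has_joins.
  exact (admissible_image (eval_monotone x) HS). }
pose (s := fun x => proj1_sig (E x)).
assert (Hs : forall x, is_join (image (eval x) S) (s x))
  by (intros x; exact (proj2_sig (E x))).
clearbody s; clear E.
assert (Ms : monotone s).
{ intros x x' Hx; apply (proj2 (Hs x)); intros y [f [Hf ->]].
  apply le_trans with (f x').
  - exact (proj1 (fn_continuous f) _ _ Hx).
  - apply (proj1 (Hs x')); now exists f. }
assert (Cs : continuous V s).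
{ split; [exact Ms |]; intros T t HT Ht; split.
  - intros y [x [Hx ->]]; apply Ms, (proj1 Ht), Hx.
  - intros y Hy; apply (proj2 (Hs t)); intros z [f [Hf ->]].
    apply (proj2 (proj2 (fn_continuous f) _ _ HT Ht)).
    intros w [x [Hx ->]]; apply le_trans with (s x).
    + apply (proj1 (Hs x)); now exists f.
    + apply Hy; now exists x. }
exists (Build_Hom Cs); exact Hs.
Qed.

Lemma join_pointwise (S : hom_poset X Y -> Prop) (s : hom_poset X Y) :
  admissible V S -> is_join S s ->
  forall x, is_join (image (eval x) S) (eval x s).
Proof.
intros HS Hs; destruct (pointwise_join_exists HS) as [t Ht].
now rewrite (join_unique Hs (pointwise_join Ht)).
Qed.

Lemma hom_poset_joins (S : hom_poset X Y -> Prop) :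
  admissible V S -> exists s, is_join S s.
Proof.
intros HS; destruct (pointwise_join_exists HS) as [s Hs].
exists s; now apply pointwise_join.
Qed.

Definition exp : Obj V := {| poset := hom_poset X Y; has_joins := hom_poset_joins |}.

End HomJoins.

(** * Categories enriched over V *)

(* Composition is given in curried form, as a morphism
   hom b c -> [hom a b, hom a c] of V. *)
Record VCat (V : base) : Type := {
  ob :> Type;
  hom : ob -> ob -> Obj V;
  idm : forall a, hom a a;
  comp : forall a b c, Hom (hom b c) (exp (hom a b) (hom a c));
  compose := fun a b c (g : hom b c) (f : hom a b) =>
    fn (fn (comp a b c) g : Hom (hom a b) (hom a c)) f;
  compose_idl : forall a b (f : hom a b), compose (idm b) f = f;
  compose_idr : forall a b (f : hom a b), compose f (idm a) = f;
  compose_assoc : forall a b c d (h : hom c d) (g : hom b c) (f : hom a b),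
    compose h (compose g f) = compose (compose h g) f }.

Arguments hom {V} _ _ _.
Arguments idm {V _} a.
Arguments comp {V} _ _ _ _.
Arguments compose {V _ a b c} g f.

Notation "g ∘ f" := (compose g f) (at level 40, left associativity).

Record VFunctor (V : base) (A B : VCat V) : Type := {
  fob :> A -> B;
  fmap : forall a a', Hom (hom A a a') (hom B (fob a) (fob a'));
  fmap_id : forall a, fmap a a (idm a) = idm (fob a);
  fmap_comp : forall a b c (g : hom A b c) (f : hom A a b),
    fmap a c (g ∘ f) = fmap b c g ∘ fmap a b f }.

Arguments fmap {V A B} _ {a a'}.

(* Since the hom-objects of V are posets with extra properties, V-naturality is
   naturality of the underlying family. *)
Record VTrans (V : base) (A B : VCat V) (F G : VFunctor A B) : Type := {
  tcomp :> forall a, hom B (F a) (G a);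
  tcomp_natural : forall a a' (f : hom A a a'),
    tcomp a' ∘ fmap F f = fmap G f ∘ tcomp a }.

Definition trans_id (V : base) (A B : VCat V) (F : VFunctor A B) : VTrans F F.
Proof.
refine {| tcomp := fun a => idm (F a) |}.
intros a a' f; now rewrite compose_idl, compose_idr.
Defined.

Definition functor_comp (V : base) (A B C : VCat V)
    (G : VFunctor B C) (F : VFunctor A B) : VFunctor A C.
Proof.
refine {| fob := fun a => G (F a);
          fmap := fun a a' => hom_comp (@fmap _ _ _ G (F a) (F a')) (@fmap _ _ _ F a a') |}.
- intros a; simpl; now rewrite !fmap_id.
- intros a b c g f; simpl; now rewrite !fmap_comp.
Defined.

(** ** Enriched left Kan extensions *)

Section LeftKan.
Variables (V : base) (A B C : VCat V).
Variables (K : VFunctor A B) (G : VFunctor A C).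

(* The V-natural transformations B(K-, x) -> C(G-, c), i.e. the elements of
   [A^op, V](B(K-, x), C(G-, c)). *)
Record Cylinder (x : B) (c : C) : Type := {
  cyl :> forall a, Hom (hom B (K a) x) (hom C (G a) c);
  cyl_natural : forall a a' (f : hom A a a') (h : hom B (K a') x),
    cyl a (h ∘ fmap K f) = cyl a' h ∘ fmap G f }.

(* The transformation eta : G -> L K exhibits L as Lan_K G when every L x is the
   colimit of G weighted by B(K-, x), i.e. when
     C(L x, c) -> [A^op, V](B(K-, x), C(G-, c)),   g |-> (h |-> g . L h . eta)
   is an isomorphism for all x and c: a surjection which reflects the order
   (it is always monotone). *)
Definition is_left_kan (L : VFunctor B C) (eta : VTrans G (functor_comp L K)) : Prop :=
  forall (x : B) (c : C),
    (forall phi : Cylinder x c,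
       exists g : hom C (L x) c,
         forall a (h : hom B (K a) x), phi a h = g ∘ (fmap L h ∘ eta a)) /\
    (forall g g' : hom C (L x) c,
       (forall a (h : hom B (K a) x),
          g ∘ (fmap L h ∘ eta a) ⊑ g' ∘ (fmap L h ∘ eta a)) ->
       g ⊑ g').

End LeftKan.

(** ** V as a category enriched over itself *)

Lemma continuous_postcomp (V : base) (X Y Z : Obj V) (g : Hom Y Z) :
  continuous V (hom_comp g : exp X Y -> exp X Z).
Proof.
split.
- intros f f' H x; exact (proj1 (fn_continuous g) _ _ (H x)).
- intros S s HS Hs; apply pointwise_join; intros x.
  pose proof (join_pointwise HS Hs x) as Hx.
  pose proof (admissible_image (@eval_monotone V X Y x) HS) as Hx'.
  destruct (proj2 (fn_continuous g) _ _ Hx' Hx) as [Hu Hl]; split.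
  + intros z [k [[f [Hf ->]] ->]]; apply Hu.
    exists (f x); split; auto; now exists f.
  + intros z Hz; apply Hl; intros w [y [[f [Hf ->]] ->]].
    apply Hz; exists (hom_comp g f); split; auto; now exists f.
Qed.

Definition postcomp (V : base) (X Y Z : Obj V) (g : Hom Y Z) : Hom (exp X Y) (exp X Z) :=
  {| fn := hom_comp g : exp X Y -> exp X Z; fn_continuous := continuous_postcomp X g |}.

Lemma continuous_compose (V : base) (X Y Z : Obj V) :
  continuous V (@postcomp V X Y Z : exp Y Z -> exp (exp X Y) (exp X Z)).
Proof.
split.
- intros g g' H f x; exact (H (fn f x)).
- intros S s HS Hs; apply pointwise_join; intros f; apply pointwise_join; intros x.
  destruct (join_pointwise HS Hs (fn f x)) as [Hu Hl]; split.
  + intros z [k [[p [[g [Hg ->]] ->]] ->]]; apply Hu; now exists g.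
  + intros z Hz; apply Hl; intros w [g [Hg ->]].
    apply Hz; exists (hom_comp g f); split; auto.
    exists (postcomp X g); split; auto; now exists g.
Qed.

Definition self (V : base) : VCat V.
Proof.
refine {| ob := Obj V;
          hom := @exp V;
          idm := @hom_id V;
          comp := fun X Y Z =>
            {| fn := @postcomp V X Y Z : exp Y Z -> exp (exp X Y) (exp X Z);
               fn_continuous := @continuous_compose V X Y Z |} |}.
- intros X Y f; now apply hom_ext.
- intros X Y f; now apply hom_ext.
- intros W X Y Z h g f; now apply hom_ext.
Defined.

Definition Endofunctor (V : base) : Type := VFunctor (self V) (self V).

(** * Finite sets and the embedding K *)

Lemma eq_order (A : Type) : order A (@eq A).
Proof. split; red; congruence. Qed.

Definition discrete_poset (A : Type) : Poset :=
  {| carrier := A; le := @eq A; le_order := eq_order A |}.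

Lemma admissible_discrete (V : base) (A : Type) (S : discrete_poset A -> Prop) :
  admissible V S -> exists s, forall x, S x <-> x = s.
Proof.
destruct V; simpl.
- tauto.
- intros [u [Hu HS]]; exists (u 0).
  assert (E : forall n, u n = u 0).
  { induction n as [|n IH]; [reflexivity |].
    transitivity (u n); [symmetry; exact (Hu n) | exact IH]. }
  intros x; rewrite HS; split.
  + intros [n ->]; apply E.
  + intros ->; now exists 0.
- intros [[s Hs] Hd]; exists s; intros x; split.
  + intros Hx; destruct (Hd x s Hx Hs) as [z [_ [H1 H2]]].
    exact (eq_trans H1 (eq_sym H2)).
  + now intros ->.
Qed.

Lemma discrete_joins (V : base) (A : Type) (S : discrete_poset A -> Prop) :
  admissible V S -> exists s, is_join S s.
Proof.
intros HS; destruct (admissible_discrete HS) as [s Hs]; exists s; split.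
- intros x Hx; now apply Hs.
- intros y Hy; apply Hy; now apply Hs.
Qed.

Definition discrete (V : base) (A : Type) : Obj V :=
  {| poset := discrete_poset A; has_joins := @discrete_joins V A |}.

Lemma continuous_discrete (V : base) (A : Type) (Y : Poset) (f : A -> Y) :
  continuous V (f : discrete V A -> Y).
Proof.
split.
- intros x y H; change (x = y) in H; subst y; apply le_refl.
- intros S s HS [Hu Hl]; destruct (admissible_discrete HS) as [t Ht].
  assert (E : t = s) by (apply Hu, Ht; reflexivity); subst t; split.
  + intros y [x [Hx ->]]; apply Ht in Hx; subst x; apply le_refl.
  + intros y Hy; apply Hy; exists s; split; auto; now apply Ht.
Qed.

Definition from_discrete (V : base) (A : Type) (Y : Obj V) (f : A -> Y) :
    Hom (discrete V A) Y :=
  {| fn := f : discrete V A -> Y; fn_continuous := continuous_discrete V f |}.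

Record FinSet : Type := {
  elt :> Type;
  elt_finite : Finite elt }.

Definition SetFin (V : base) : VCat V.
Proof.
refine {| ob := FinSet;
          hom := fun m n => discrete V (m -> n);
          idm := fun m => (fun i : m => i);
          comp := fun m n p =>
            from_discrete (fun g : n -> p =>
              from_discrete (fun f : m -> n => (fun i => g (f i)) : discrete V (m -> p))
                : exp (discrete V (m -> n)) (discrete V (m -> p))) |};
  reflexivity.
Defined.

Definition K (V : base) : VFunctor (SetFin V) (self V).
Proof.
refine {| fob := (fun n : FinSet => discrete V n) : SetFin V -> self V;
          fmap := fun m n : FinSet =>
            from_discrete (fun f : m -> n =>
              from_discrete (f : m -> discrete V n) : exp (discrete V m) (discrete V n)) |}.
- intros n; now apply hom_ext.
- intros m n p g f; now apply hom_ext.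
Defined.

Definition strongly_finitary (V : base) (T : Endofunctor V) : Prop :=
  is_left_kan (L := T) (trans_id (functor_comp T (K V))).

(** * Directed colimits *)

Definition directed_poset (D : Poset) : Prop := is_directed (fun _ : D => True).

Record Diagram (V : base) (D : Poset) : Type := {
  dob :> D -> self V;
  dmap : forall i j, i ⊑ j -> hom (self V) (dob i) (dob j);
  dmap_id : forall i (p : i ⊑ i), dmap p = idm (dob i);
  dmap_comp : forall i j k (p : i ⊑ j) (q : j ⊑ k) (r : i ⊑ k),
    dmap r = dmap q ∘ dmap p }.

Record Cocone (V : base) (D : Poset) (X : Diagram V D) (C : self V) : Type := {
  leg :> forall i, hom (self V) (X i) C;
  leg_natural : forall i j (p : i ⊑ j), leg j ∘ dmap X p = leg i }.

Definition is_colimit (V : base) (D : Poset) (X : Diagram V D) (C : self V)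
    (c : Cocone X C) : Prop :=
  forall (C' : self V) (c' : Cocone X C'),
    exists! u : hom (self V) C C', forall i, u ∘ c i = c' i.

Definition map_diagram (V : base) (D : Poset) (T : Endofunctor V) (X : Diagram V D) :
    Diagram V D.
Proof.
refine {| dob := fun i => T (X i); dmap := fun i j p => fmap T (dmap X p) |}.
- intros i p; now rewrite dmap_id, fmap_id.
- intros i j k p q r; now rewrite (dmap_comp X p q r), fmap_comp.
Defined.

Definition map_cocone (V : base) (D : Poset) (T : Endofunctor V) (X : Diagram V D)
    (C : self V) (c : Cocone X C) : Cocone (map_diagram T X) (T C).
Proof.
refine {| leg := (fun i => fmap T (c i)) :
            forall i, hom (self V) (map_diagram T X i) (T C) |}.
intros i j p; rewrite <- (leg_natural c p).
symmetry; exact (fmap_comp T (c j) (dmap X p)).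
Defined.

Definition preserves_directed_colimits (V : base) (T : Endofunctor V) : Prop :=
  forall (D : Poset) (X : Diagram V D) (C : self V) (c : Cocone X C),
    directed_poset D -> is_colimit c -> is_colimit (map_cocone T c).

(** * Coinserters *)

Section Coinserters.
Variable V : base.

Definition is_coinserter (A B C : self V) (f0 f1 : hom (self V) A B)
    (c : hom (self V) B C) : Prop :=
  c ∘ f0 ⊑ c ∘ f1 /\
  (forall (D : self V) (c' : hom (self V) B D),
     c' ∘ f0 ⊑ c' ∘ f1 -> exists u : hom (self V) C D, u ∘ c = c') /\
  (forall (D : self V) (u v : hom (self V) C D), u ∘ c ⊑ v ∘ c -> u ⊑ v).

Definition reflexive_pair (A B : self V) (f0 f1 : hom (self V) A B) : Prop :=
  exists d : hom (self V) B A, f0 ∘ d = idm B /\ f1 ∘ d = idm B.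

Definition surjective (B C : self V) (c : hom (self V) B C) : Prop :=
  Surjective (fn (c : Hom B C)).

Definition preserves_reflexive_surjective_coinserters (T : Endofunctor V) : Prop :=
  forall (A B C : self V) (f0 f1 : hom (self V) A B) (c : hom (self V) B C),
    reflexive_pair f0 f1 -> is_coinserter f0 f1 c -> surjective c ->
    is_coinserter (fmap T f0) (fmap T f1) (fmap T c).

End Coinserters.

(* Main.v *)
Require Import Defs.
From Stdlib Require Import List FinFun FunctionalExtensionality PropExtensionality.
From Stdlib Require Import ProofIrrelevance ClassicalEpsilon.

Set Implicit Arguments.
Unset Strict Implicit.
Unset Printing Implicit Defensive.

(** Strong finitarity says that, at every object x, the maps T x -> c correspond to
    the natural families x^n -> [T n, c] indexed by the finite discrete objects n.
    Two facts carry the proof.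

    First, finite powers commute with directed colimits and with reflexive
    coinserters.  Both are universal solutions of a system of inequations (legs
    c_i : X_i -> C subject to c_i s <= c_j t), so they are treated at once: such a
    system is called sifted when a solution in one variable ranging over a power
    X_i^(1+A) decouples into a solution in two independent variables, which holds
    for directed diagrams because two indices have an upper bound, and for
    reflexive pairs because of the common section.  Since V is cartesian closed, a
    two-variable solution extends along c_i one variable at a time, and induction
    on the exponent gives [power_universal].  If T is strongly finitary, a solution
    T X_i -> D is therefore a natural family of solutions X_i^n -> [T n, D], which
    extends to C^n and then to a map T C -> D: T preserves the universal solution
    ([strongly_finitary_universal]).

    Conversely, let T preserve these colimits.  By the same commutation of powers
    the objects at which T has the Kan property are closed under the colimits in
    question ([universal_fillable], [universal_generated]), and they contain the
    finite discrete objects by the Yoneda lemma.  Every object x is then reached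
    in three steps: a finite poset is a reflexive surjective coinserter of finite
    discrete ones; the free object B(P) of V on a poset P is the directed colimit
    of the finite subposets of P; and the map B(x) -> x computing joins is a
    reflexive surjective coinserter of two maps B(Q) -> B(x), where Q is the poset
    of pairs (I, J) in B(x) with join I <= join J.  Passing through B(x) is what
    accounts for continuity: over CPO and DCPO a diagram of finite posets over x
    only sees the monotone maps out of x. *)

(** * Continuous maps *)

Lemma le_eq (X : Poset) (x x' y y' : X) : x = x' -> y = y' -> x' ⊑ y' -> x ⊑ y.
Proof. now intros -> ->. Qed.

Lemma hom_mono (V : base) (X Y : Obj V) (f : Hom X Y) x x' : x ⊑ x' -> f x ⊑ f x'.
Proof. exact (proj1 (fn_continuous f) x x'). Qed.

Lemma admissible_directed (V : base) (X : Poset) (S : X -> Prop) :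
  admissible V S -> is_directed S.
Proof.
destruct V; simpl; [tauto | | trivial].
intros [u [Hu HS]].
assert (M : forall m n, u n ⊑ u (m + n)).
{ induction m as [|m IH]; intros n; simpl; [apply le_refl |].
  exact (le_trans (IH n) (Hu _)). }
split; [exists (u 0); apply HS; now exists 0 |].
intros x y Hx Hy; apply HS in Hx; apply HS in Hy.
destruct Hx as [m ->], Hy as [n ->]; exists (u (m + n)); split.
- apply HS; now exists (m + n).
- split; [rewrite PeanoNat.Nat.add_comm |]; apply M.
Qed.

(** Uncurrying, composed with a pairing.  The join of the values over S is first
    taken in each variable separately; a pair of elements of S is then dominated by
    a single one because admissible subsets are directed. *)
Lemma continuous_apply2 (V : base) (X Y Z D : Obj V) (f : Hom X (exp Y D))
    (a : Hom Z X) (b : Hom Z Y) :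
  continuous V (fun z => fn (f (a z) : Hom Y D) (b z)).
Proof.
assert (M : forall x x' y y', x ⊑ x' -> y ⊑ y' ->
          fn (f x : Hom Y D) y ⊑ fn (f x' : Hom Y D) y').
{ intros x x' y y' Hx Hy; apply le_trans with (fn (f x : Hom Y D) y').
  - now apply hom_mono.
  - exact (hom_mono f Hx y'). }
split; [intros z z' Hz; apply M; now apply hom_mono |].
intros S s HS Hs.
pose proof (proj2 (fn_continuous a) _ _ HS Hs) as Ja.
pose proof (proj2 (fn_continuous b) _ _ HS Hs) as Jb.
pose proof (admissible_image (proj1 (fn_continuous a)) HS) as Aa.
pose proof (admissible_image (proj1 (fn_continuous b)) HS) as Ab.
split.
- intros d [z [Hz ->]]; apply M; apply hom_mono; now apply (proj1 Hs).
- intros d Hd.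
  pose proof (proj2 (fn_continuous f) _ _ Aa Ja) as Jf.
  pose proof (admissible_image (proj1 (fn_continuous f)) Aa) as Af.
  apply (proj2 (join_pointwise Af Jf (b s))).
  intros w [k [[x [[z [Hz ->]] ->]] ->]].
  apply (proj2 (proj2 (fn_continuous (f (a z) : Hom Y D)) _ _ Ab Jb)).
  intros w [y [[z' [Hz' ->]] ->]].
  destruct (proj2 (admissible_directed HS) z z' Hz Hz') as [z2 [H2 [L L']]].
  apply le_trans with (fn (f (a z2) : Hom Y D) (b z2)).
  + apply M; now apply hom_mono.
  + apply Hd; now exists z2.
Qed.

Definition apply2 (V : base) (X Y Z D : Obj V) (f : Hom X (exp Y D))
    (a : Hom Z X) (b : Hom Z Y) : Hom Z D :=
  {| fn := fun z => fn (f (a z) : Hom Y D) (b z);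
     fn_continuous := continuous_apply2 f a b |}.

Lemma continuous_exp (V : base) (X Y D : Obj V) (f : X -> exp Y D) :
  (forall y, continuous V (fun x => fn (f x : Hom Y D) y)) -> continuous V f.
Proof.
intros H; split.
- intros x x' Hx y; exact (proj1 (H y) _ _ Hx).
- intros S s HS Hs; apply pointwise_join; intros y.
  destruct (proj2 (H y) _ _ HS Hs) as [Hu Hl]; split.
  + intros w [k [[x [Hx ->]] ->]]; apply Hu; now exists x.
  + intros d Hd; apply Hl; intros w [x [Hx ->]]; apply Hd.
    exists (f x); split; auto; now exists x.
Qed.

Definition to_exp (V : base) (X Y D : Obj V) (f : X -> exp Y D)
    (Hf : forall y, continuous V (fun x => fn (f x : Hom Y D) y)) : Hom X (exp Y D) :=
  {| fn := f; fn_continuous := continuous_exp Hf |}.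

Lemma continuous_const (V : base) (X Y : Obj V) (y : Y) : continuous V (fun _ : X => y).
Proof.
split; [intros x x' _; apply le_refl |].
intros S s HS _; destruct (proj1 (admissible_directed HS)) as [x Hx]; split.
- intros w [x' [_ ->]]; apply le_refl.
- intros w Hw; apply Hw; now exists x.
Qed.

Definition const (V : base) (X Y : Obj V) (y : Y) : Hom X Y :=
  {| fn := fun _ => y; fn_continuous := @continuous_const V X Y y |}.

Definition eval_at (V : base) (X Y : Obj V) (x : X) : Hom (exp X Y) Y :=
  apply2 (hom_id (exp X Y)) (hom_id _) (const _ x).

Definition flip (V : base) (X Y D : Obj V) (f : Hom X (exp Y D)) : Hom Y (exp X D) :=
  to_exp (f := fun y => apply2 f (hom_id X) (const X y) : exp X D)
         (fun x => fn_continuous (f x : Hom Y D)).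

(** * Endofunctors *)

Section Functors.
Variables (V : base) (F : Endofunctor V).

Definition act (X Y : Obj V) (f : Hom X Y) : Hom (F X) (F Y) := fmap F f.

Lemma act_id (X : Obj V) t : act (hom_id X) t = t.
Proof. unfold act; change (hom_id X) with (@idm _ (self V) X); now rewrite fmap_id. Qed.

Lemma act_comp (X Y Z : Obj V) (g : Hom Y Z) (f : Hom X Y) t :
  act (hom_comp g f) t = act g (act f t).
Proof.
exact (f_equal (fun h : Hom (F X) (F Z) => h t) (fmap_comp F g f)).
Qed.

Lemma act_mono (X Y : Obj V) (f g : Hom X Y) t :
  (forall x, f x ⊑ g x) -> act f t ⊑ act g t.
Proof. intros H; exact (hom_mono (fmap F) (H : (f : exp X Y) ⊑ g) t). Qed.

End Functors.

Arguments act_comp {V} F {X Y Z} g f t.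

Definition id_functor (V : base) : Endofunctor V.
Proof.
refine {| fob := (fun X => X) : self V -> self V;
          fmap := fun X Y : Obj V => hom_id (exp X Y) |}; reflexivity.
Defined.

(** The A-th power, as the functor represented by the discrete object on A, so that
    the component at n of a cylinder at x is a morphism out of [pow V n x]. *)
Definition pow (V : base) (A : Type) : Endofunctor V.
Proof.
refine {| fob := exp (discrete V A) : self V -> self V;
          fmap := fun X Y => comp (self V) (discrete V A) X Y |}.
- intros X; apply hom_ext; intros h; now apply hom_ext.
- intros X Y Z g f; apply hom_ext; intros h; now apply hom_ext.
Defined.

Definition tup (V : base) (A : Type) (X : Obj V) (h : A -> X) : pow V A X :=
  from_discrete h.

(** * Systems of inequations *)

(** A presentation of a weighted colimit: an unknown on each [obj i] and, for each
    r, an inequation between unknowns precomposed with [lmap r] and [rmap r]. *)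
Record System (V : base) : Type := {
  index : Type;
  obj : index -> Obj V;
  rel : Type;
  dom : rel -> Obj V;
  lindex : rel -> index;
  rindex : rel -> index;
  lmap : forall r, Hom (dom r) (obj (lindex r));
  rmap : forall r, Hom (dom r) (obj (rindex r)) }.

Section Universal.
Variables (V : base) (F : Endofunctor V) (S : System V).

Definition satisfies (D : Obj V) (g : forall i : index S, Hom (F (obj i)) D) : Prop :=
  forall r (y : F (dom r)),
    g (lindex r) (act F (lmap r) y) ⊑ g (rindex r) (act F (rmap r) y).

(** F sends the cocone c to a colimit of the presentation, in the enriched sense:
    maps out of [F C] are compared through the legs.  Taking F to be the identity, a
    power or T expresses that c is a colimit, that powers commute with it, and that
    T preserves it. *)
Definition universal (C : Obj V) (c : forall i : index S, Hom (obj i) C) : Prop :=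
  (forall (D : Obj V) (g : forall i : index S, Hom (F (obj i)) D), satisfies g ->
     exists u : Hom (F C) D, forall i x, u (act F (c i) x) = g i x) /\
  (forall (D : Obj V) (u v : Hom (F C) D),
     (forall i x, u (act F (c i) x) ⊑ v (act F (c i) x)) -> forall t, u t ⊑ v t).

End Universal.

Lemma universal_eq (V : base) (F : Endofunctor V) (S : System V) (C : Obj V)
    (c : forall i : index S, Hom (obj i) C) : universal F c ->
  forall (D : Obj V) (u v : Hom (F C) D),
    (forall i x, u (act F (c i) x) = v (act F (c i) x)) -> forall t, u t = v t.
Proof.
intros [_ H] D u v E t; apply le_antisym; apply H; intros i x; rewrite E; apply le_refl.
Qed.

Definition solution (V : base) (S : System V) (C : Obj V)
    (c : forall i : index S, Hom (obj i) C) : Prop :=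
  forall r (y : dom r), c (lindex r) (lmap r y) ⊑ c (rindex r) (rmap r y).

(** Local monotonicity of F is what makes inequations functorial. *)
Lemma act_solution (V : base) (F : Endofunctor V) (S : System V) (C D : Obj V)
    (c : forall i : index S, Hom (obj i) C) (u : Hom (F C) D) :
  solution c -> satisfies (fun i => hom_comp u (act F (c i))).
Proof.
intros H r y; simpl; rewrite <- !act_comp; apply hom_mono, act_mono; exact (H r).
Qed.

(** * Powers *)

Section Tuples.
Variables (V : base) (A : Type) (X : Obj V).

Definition proj (a : A) : Hom (pow V A X) X := eval_at X (a : discrete V A).

Lemma tup_ext (h k : pow V A X) : (forall a, proj a h = proj a k) -> h = k.
Proof. intros H; apply hom_ext; exact H. Qed.

Lemma continuous_tup (Z : Obj V) (f : A -> Hom Z X) :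
  continuous V (fun z => tup (fun a => f a z) : exp (discrete V A) X).
Proof. apply continuous_exp; intros a; exact (fn_continuous (f a)). Qed.

Definition tupling (Z : Obj V) (f : A -> Hom Z X) : Hom Z (pow V A X) :=
  Build_Hom (continuous_tup f).

End Tuples.

Definition reindex (V : base) (A B : Type) (s : A -> B) (X : Obj V) :
    Hom (pow V B X) (pow V A X) :=
  tupling (fun a => proj X (s a)).

Lemma reindex_act (V : base) (A B : Type) (s : A -> B) (X Y : Obj V) (f : Hom X Y) h :
  reindex s Y (act (pow V B) f h) = act (pow V A) f (reindex s X h).
Proof. now apply tup_ext. Qed.

Section Option.
Variables (V : base) (A : Type) (X : Obj V).

Definition case_option (Z : Obj V) (f : Hom Z X) (g : Hom Z (pow V A X)) :
    Hom Z (pow V (option A) X) :=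
  tupling (fun o => match o with None => f | Some a => hom_comp (proj X a) g end).

Definition tail : Hom (pow V (option A) X) (pow V A X) := reindex (@Some A) X.

Definition prepend (x : X) (h : pow V A X) : pow V (option A) X :=
  case_option (hom_id X) (const X h) x.

Lemma prepend_head_tail (h : pow V (option A) X) :
  prepend (proj X None h) (tail h) = h.
Proof. apply tup_ext; intros [a|]; reflexivity. Qed.

Lemma case_option_prepend (Z : Obj V) (f : Hom Z X) (g : Hom Z (pow V A X)) z :
  prepend (f z) (g z) = case_option f g z.
Proof. apply tup_ext; intros [a|]; reflexivity. Qed.

(** Currying along X^(1+A) = X * X^A, with each variable reindexed separately. *)
Definition curry_prepend (D Y Z : Obj V) (g : Hom (pow V (option A) X) D)
    (p : Hom Y X) (q : Hom Z (pow V A X)) : Hom Y (exp Z D).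
Proof.
refine (to_exp (f := fun y =>
  hom_comp g (case_option (const Z (p y)) q) : exp Z D) _).
intros z.
replace (fun y => _) with (fn (hom_comp g (case_option p (const Y (q z))))).
- apply fn_continuous.
- extensionality y; simpl; f_equal; apply tup_ext; intros [a|]; reflexivity.
Defined.

Lemma curry_prepend_eq (D Y Z : Obj V) (g : Hom (pow V (option A) X) D)
    (p : Hom Y X) (q : Hom Z (pow V A X)) y z :
  fn (curry_prepend g p q y : Hom Z D) z = g (prepend (p y) (q z)).
Proof. exact (f_equal g (eq_sym (case_option_prepend (const Z (p y)) q z))). Qed.

End Option.

Arguments tail {V} A X.

(** * Sifted systems *)

(** Any two unknowns are connected through a third one, uniformly in the functor F:
    at the identity this compares the legs of a cocone, and at the empty power it
    forces a solution to be constant. *)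
Definition bounded (V : base) (S : System V) : Prop :=
  forall i j : index S,
  exists (k : index S) (p : Hom (obj i) (obj k)) (q : Hom (obj j) (obj k)),
  forall (F : Endofunctor V) (D : Obj V) (g : forall i : index S, Hom (F (obj i)) D),
    satisfies g ->
    (forall x, g k (act F p x) = g i x) /\ (forall x, g k (act F q x) = g j x).

(** A solution g on the powers X_i^(1+A), in which all coordinates move together, is
    the diagonal of a family G on the products X_i * X_j^A which solves the system
    in each of its two variables while the other one is fixed. *)
Definition separable (V : base) (S : System V) : Prop :=
  forall (A : Type) (D : Obj V) (g : forall i : index S, Hom (pow V (option A) (obj i)) D),
  satisfies g ->
  exists G : forall i j : index S, Hom (obj i) (exp (pow V A (obj j)) D),
    (forall i x h, fn (G i i x : Hom _ _) h = g i (prepend x h)) /\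
    (forall r j (y : dom r) h,
       fn (G _ j (lmap r y) : Hom _ _) h ⊑ fn (G _ j (rmap r y) : Hom _ _) h) /\
    (forall i r x (h : pow V A (dom r)),
       fn (G i _ x : Hom _ _) (act (pow V A) (lmap r) h)
       ⊑ fn (G i _ x : Hom _ _) (act (pow V A) (rmap r) h)).

Definition sifted (V : base) (S : System V) : Prop :=
  inhabited (index S) /\ bounded S /\ separable S.

Section Powers.
Variables (V : base) (S : System V) (C : Obj V) (c : forall i : index S, Hom (obj i) C).
Hypotheses (Ssift : sifted S) (csol : solution c) (cuniv : universal (id_functor V) c).

(** The empty power is terminal, so a solution is a family of points; it is constant
    because the system is nonempty and any two of its legs are connected. *)
Lemma power_zero : universal (pow V Empty_set) c.
Proof.
destruct Ssift as [[i0] [B _]].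
assert (U : forall (X : Obj V) (h k : pow V Empty_set X), h = k)
  by (intros X h k; apply tup_ext; intros []).
pose (e := fun X : Obj V => @tup V Empty_set X (fun a => match a with end)).
split.
- intros D g Hg; exists (const _ (g i0 (e _))); intros i x; simpl.
  destruct (B i0 i) as [k [p [q H]]]; destruct (H _ _ _ Hg) as [E1 E2].
  rewrite <- E1, <- E2; f_equal; apply U.
- intros D u v H t; rewrite (U _ t (act _ (c i0) (e _))); apply H.
Qed.

(** Cartesian closedness at work: the family G of [separable] is extended from the
    X_j^A to C^A with values in [X_i, D], and the result, flipped, from the X_i to C
    with values in [C^A, D]. *)
Lemma power_succ (A : Type) : universal (pow V A) c -> universal (pow V (option A)) c.
Proof.
intros [Ex Epi]; destruct cuniv as [Ex1 Epi1], Ssift as [_ [B Sep]]; split.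
- intros D g Hg; destruct (Sep _ _ _ Hg) as [G [G1 [G2 G3]]].
  assert (Hu : forall i, exists u : Hom (pow V A C) (exp (obj i) D),
      forall j h x, fn (u (act (pow V A) (c j) h) : Hom _ _) x = fn (G i j x : Hom _ _) h).
  { intros i; destruct (Ex _ (fun j => flip (G i j))) as [u Hu].
    - intros r h x; exact (G3 i r x h).
    - exists u; intros j h x; now rewrite Hu. }
  pose (u := fun i => proj1_sig (constructive_indefinite_description _ (Hu i))).
  assert (Eu : forall i j h x, fn (u i (act (pow V A) (c j) h) : Hom _ _) x
                               = fn (G i j x : Hom _ _) h)
    by (intros i; exact (proj2_sig (constructive_indefinite_description _ (Hu i)))).
  clearbody u.
  destruct (Ex1 _ (fun i => flip (u i))) as [w Hw].
  { intros r y h.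
    apply (Epi _ (flip (u (lindex r)) (lmap r y)) (flip (u (rindex r)) (rmap r y))).
    intros j h'; exact (le_eq (Eu _ _ _ _) (Eu _ _ _ _) (G2 r j y h')). }
  exists (apply2 w (proj C None) (tail A C)); intros i h.
  transitivity (fn (w (c i (proj _ None h)) : Hom (pow V A C) D)
                   (act (pow V A) (c i) (tail A _ h))).
  + simpl; f_equal; apply reindex_act.
  + refine (eq_trans (f_equal (fun k : Hom (pow V A C) D => k _) (Hw i _)) _).
    refine (eq_trans (Eu i i _ _) (eq_trans (G1 i _ _) _)).
    apply f_equal, prepend_head_tail.
- intros D u v H t; apply (le_eq (f_equal u (eq_sym (prepend_head_tail t)))
                                (f_equal v (eq_sym (prepend_head_tail t)))).
  generalize (proj C None t) (tail A C t); clear t; intros x h.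
  apply (Epi1 _ (hom_comp u (case_option (hom_id C) (const C h)))
                (hom_comp v (case_option (hom_id C) (const C h)))); clear x.
  intros i x.
  pose (k := case_option (const (pow V A C) (c i x)) (hom_id (pow V A C))).
  assert (Ek : forall h, prepend (c i x) h = k h)
    by (intros h'; exact (case_option_prepend (const _ (c i x)) (hom_id _) h')).
  apply (le_eq (f_equal u (Ek h)) (f_equal v (Ek h))).
  apply (Epi _ (hom_comp u k) (hom_comp v k)); clear h.
  intros j h.
  apply (le_eq (f_equal u (eq_sym (Ek _))) (f_equal v (eq_sym (Ek _)))); clear k Ek.
  (* The two variables now lie over different legs; a common one reduces to [H]. *)
  destruct (B i j) as [k [p [q Hk]]].
  destruct (Hk (id_functor V) _ _ csol) as [E1 E2].
  replace (prepend (c i x) (act (pow V A) (c j) h))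
    with (act (pow V (option A)) (c k) (prepend (p x) (act (pow V A) q h))).
  + apply H.
  + apply tup_ext; intros [a|].
    * exact (E2 (proj _ a h)).
    * exact (E1 x).
Qed.

(** Exponents need only be reached up to retracts, which spares a bijection between a
    finite type and a standard one: C^A is a natural retract of C^B. *)
Lemma power_retract (A B : Type) (s : A -> B) (r : B -> A) :
  (forall a, r (s a) = a) -> universal (pow V B) c -> universal (pow V A) c.
Proof.
intros rs [Ex Epi].
assert (MR : forall (X : Obj V) (h : pow V A X), reindex s X (reindex r X h) = h).
{ intros X h; apply tup_ext; intros a; exact (f_equal (fn (h : Hom (discrete V A) X)) (rs a)). }
split.
- intros D g Hg.
  destruct (Ex D (fun i => hom_comp (g i) (reindex s (obj i)))) as [u Hu].
  { intros k h.
    exact (le_eq (f_equal (g _) (reindex_act _ _ _)) (f_equal (g _) (reindex_act _ _ _))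
                 (Hg k _)). }
  exists (hom_comp u (reindex r C)); intros i h.
  refine (eq_trans (f_equal u (reindex_act _ _ _)) (eq_trans (Hu i _) _)).
  exact (f_equal (g i) (MR _ h)).
- intros D u v H t; apply (le_eq (f_equal u (eq_sym (MR _ t))) (f_equal v (eq_sym (MR _ t)))).
  apply (Epi _ (hom_comp u (reindex s C)) (hom_comp v (reindex s C))); intros i h.
  exact (le_eq (f_equal u (reindex_act _ _ _)) (f_equal v (reindex_act _ _ _)) (H i _)).
Qed.

Fixpoint options (n : nat) : Type :=
  match n with O => Empty_set | Datatypes.S n => option (options n) end.

Lemma finite_retract (A : Type) : Finite A ->
  exists n (s : A -> options n) (r : options n -> A), forall a, r (s a) = a.
Proof.
intros [l Hl].
assert (H : exists n (r : options n -> A), forall a, In a l -> exists b, r b = a).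
{ clear Hl; induction l as [|a l [n [r IH]]].
  - exists 0, (fun b : Empty_set => match b with end); intros a [].
  - exists (Datatypes.S n), (fun o : option (options n) => match o with None => a | Some b => r b end); intros a' [-> | Ha'].
    + now exists None.
    + destruct (IH a' Ha') as [b <-]; now exists (Some b). }
destruct H as [n [r H]].
exists n, (fun a => proj1_sig (constructive_indefinite_description _ (H a (Hl a)))), r.
intros a; apply proj2_sig.
Qed.

Theorem power_universal (A : Type) : Finite A -> universal (pow V A) c.
Proof.
intros HA; destruct (finite_retract HA) as [n [s [r rs]]].
apply (power_retract rs); clear s r rs.
induction n; [apply power_zero | now apply power_succ].
Qed.

End Powers.

(** * The Kan property at one object *)

Section Pointwise.
Variables (V : base) (T : Endofunctor V).

Definition KanCylinder (x c : Obj V) : Type :=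
  Cylinder (K V) (functor_comp T (K V)) x c.

Definition cyl_at (x c : Obj V) (phi : KanCylinder x c) (n : FinSet) :
  Hom (pow V n x) (exp (T (discrete V n)) c) := phi n.

Definition cyl_app (x c : Obj V) (phi : KanCylinder x c) (n : FinSet)
    (h : pow V n x) : Hom (T (discrete V n)) c := phi n h.

(** The two halves of the universal property of T x as a colimit weighted by
    the powers of x.  They are separate because closure under colimits uses them at
    different objects: fillers are taken at each [obj i], and they are compared by
    generation at each [dom r]. *)
Definition fillable (x : Obj V) : Prop :=
  forall (c : Obj V) (phi : KanCylinder x c),
  exists g : Hom (T x) c, forall (n : FinSet) (h : Hom (discrete V n) x) t,
    cyl_app phi h t = g (act T h t).

Definition generated (x : Obj V) : Prop :=
  forall (c : Obj V) (u v : Hom (T x) c),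
  (forall (n : FinSet) (h : Hom (discrete V n) x) t, u (act T h t) ⊑ v (act T h t)) ->
  forall t, u t ⊑ v t.

Lemma strongly_finitary_pointwise :
  strongly_finitary T <-> forall x, fillable x /\ generated x.
Proof.
split.
- intros H x; split.
  + intros c phi; destruct (proj1 (H x c) phi) as [g Hg]; exists g; intros n h t.
    assert (E := Hg n h); rewrite compose_idr in E.
    exact (f_equal (fun k : Hom (T (discrete V n)) c => k t) E).
  + intros c u v E; refine (proj2 (H x c) u v _); intros n h; rewrite compose_idr.
    exact (E n h).
- intros H x c; split.
  + intros phi; destruct (proj1 (H x) c phi) as [g Hg]; exists g; intros n h.
    rewrite compose_idr; apply hom_ext; exact (Hg n h).
  + intros u v E; refine (proj2 (H x) c u v _); intros n h.
    assert (E' := E n h); rewrite compose_idr in E'; exact E'.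
Qed.

Lemma generated_eq (x c : Obj V) (u v : Hom (T x) c) : generated x ->
  (forall (n : FinSet) (h : Hom (discrete V n) x) t, u (act T h t) = v (act T h t)) ->
  forall t, u t = v t.
Proof.
intros H E t; apply le_antisym; apply H; intros n h s; rewrite E; apply le_refl.
Qed.

Definition cyl_reindex (x c : Obj V) (phi : KanCylinder x c) (m n : FinSet)
    (f : m -> n) (h : Hom (discrete V n) x) t :
  cyl_app phi (hom_comp h (from_discrete (f : m -> discrete V n))) t
  = cyl_app phi h (act T (from_discrete (f : m -> discrete V n)) t) :=
  f_equal (fun k : Hom (T (discrete V m)) c => k t)
    (cyl_natural phi (f : discrete V (m -> n)) h).

Definition cyl_restrict (x y c : Obj V) (f : Hom x y) (phi : KanCylinder y c) :
  KanCylinder x c.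
Proof.
refine (@Build_Cylinder V _ _ _ (K V) (functor_comp T (K V)) x c
          (fun n : FinSet => hom_comp (cyl_at phi n) (act (pow V n) f)) _).
intros m n g h; refine (eq_trans _ (cyl_natural phi g (hom_comp f h))).
apply (f_equal (fn (phi m))); now apply hom_ext.
Defined.

(** The Yoneda lemma: a cylinder at a finite discrete object is determined by its
    value at the identity. *)
Lemma fillable_finite (n : FinSet) : fillable (discrete V n).
Proof.
intros c phi; exists (cyl_app phi (hom_id (discrete V n))); intros m h t.
assert (E : h = from_discrete (fn h : m -> discrete V n)) by now apply hom_ext.
rewrite E, <- cyl_reindex; f_equal; f_equal; now apply hom_ext.
Qed.

Lemma generated_finite (n : FinSet) : generated (discrete V n).
Proof.
intros c u v H t; rewrite <- (act_id (F := T) t); apply H.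
Qed.

(** For a fixed t, both sides of the equation defining a filler are morphisms of V in
    the tuple h, hence can be compared along a family of legs that is epimorphic on
    powers. *)
Definition cyl_value (x c : Obj V) (phi : KanCylinder x c) (n : FinSet)
    (t : T (discrete V n)) : Hom (pow V n x) c :=
  hom_comp (eval_at c t) (cyl_at phi n).

Definition act_value (x c : Obj V) (g : Hom (T x) c) (n : FinSet)
    (t : T (discrete V n)) : Hom (pow V n x) c :=
  hom_comp g (hom_comp (eval_at (T x) t) (fmap T : Hom (exp (discrete V n) x) _)).

End Pointwise.

Section Transfer.
Variables (V : base) (T : Endofunctor V) (S : System V) (C : Obj V).
Variable c : forall i : index S, Hom (obj i) C.
Hypotheses (csol : solution c)
  (cpow : forall n : FinSet, universal (pow V n) c).

(** A solution g on the T X_i induces, for each n, the solution h |-> g_i . T h on the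
    powers X_i^n.  Its extensions to the C^n form a cylinder, and the filler of that
    cylinder extends g. *)
Theorem strongly_finitary_universal : strongly_finitary T -> universal T c.
Proof.
intros KT; pose proof (proj1 (strongly_finitary_pointwise T) KT) as P; clear KT.
split.
- intros D g Hg.
  pose (a := fun (n : FinSet) i =>
    hom_comp (postcomp (T (discrete V n)) (g i))
             (fmap T : Hom (exp (discrete V n) (obj i)) (exp (T (discrete V n)) (T (obj i))))).
  assert (Ha : forall n : FinSet, exists u : Hom (pow V n C) (exp (T (discrete V n)) D),
             forall i h, u (act (pow V n) (c i) h) = a n i h).
  { intros n; apply (proj1 (cpow n)); intros r h t.
    refine (le_eq _ _ (Hg r (act T (h : Hom (discrete V n) _) t))).
    - apply (f_equal (g _)); exact (act_comp T (lmap r) (h : Hom (discrete V n) _) t).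
    - apply (f_equal (g _)); exact (act_comp T (rmap r) (h : Hom (discrete V n) _) t). }
  pose (phi := fun n : FinSet => proj1_sig (constructive_indefinite_description _ (Ha n))).
  assert (Hphi : forall (n : FinSet) i h, phi n (act (pow V n) (c i) h) = a n i h)
    by (intros n; exact (proj2_sig (constructive_indefinite_description _ (Ha n)))).
  clearbody phi; clear Ha.
  assert (N : forall (m n : SetFin V) (f : hom (SetFin V) m n)
      (h : hom (self V) (K V n) C),
      phi m (h ∘ fmap (K V) f) = (phi n h : hom (self V) (T (K V n)) D) ∘ fmap T (fmap (K V) f)).
  { intros m n f h; apply hom_ext; intros t.
    pose (f' := from_discrete (f : m -> discrete V n)).
    assert (R : forall (X : Obj V) (k : pow V n X),
               (reindex f X k : Hom _ _) = hom_comp (k : Hom (discrete V n) X) f')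
      by (intros X k; now apply hom_ext).
    pose (l := hom_comp (eval_at D t) (hom_comp (phi m) (reindex f C))).
    pose (r := hom_comp (eval_at D (act T f' t)) (phi n)).
    transitivity (l h).
    { apply (f_equal (fun k => fn (phi m k : Hom (T (discrete V m)) D) t)), eq_sym, R. }
    apply (universal_eq (cpow n) (u := l) (v := r)); clear h; intros i k.
    refine (eq_trans (f_equal (fun k => fn (phi m k : Hom (T (discrete V m)) D) t)
                              (reindex_act f (c i) k)) _).
    refine (eq_trans (f_equal (fun k : Hom (T (discrete V m)) D => k t) (Hphi m i _)) _).
    refine (eq_trans _ (f_equal (fun k : Hom (T (discrete V n)) D => k (act T f' t))
                                (eq_sym (Hphi n i _)))).
    apply (f_equal (g i)); refine (eq_trans _ (act_comp T (k : Hom (discrete V n) _) f' t)).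
    exact (f_equal (fun k : Hom (discrete V m) (obj i) => act T k t) (R _ k)). }
  pose (Phi := @Build_Cylinder V _ _ _ (K V) (functor_comp T (K V)) C D phi N).
  destruct (proj1 (P C) D Phi) as [u Hu]; exists u; intros i.
  apply (generated_eq (v := g i) (u := hom_comp u (act T (c i))) (proj2 (P _))).
  intros n h t; simpl fn.
  refine (eq_trans (f_equal u (eq_sym (act_comp T (c i) h t))) _).
  refine (eq_trans (eq_sym (Hu n (hom_comp (c i) h) t)) _).
  exact (f_equal (fun k : Hom (T (discrete V n)) D => k t) (Hphi n i h)).
- intros D u v H; apply (proj2 (P C)); intros n h t.
  apply (proj2 (cpow n) D (act_value u t) (act_value v t)); intros i k.
  refine (le_eq _ _ (H i (act T (k : Hom (discrete V n) _) t))).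
  + apply (f_equal u), (act_comp T (c i) (k : Hom (discrete V n) _)).
  + apply (f_equal v), (act_comp T (c i) (k : Hom (discrete V n) _)).
Qed.

(** A cylinder at C restricts along each leg to a cylinder at X_i; the fillers of
    these form a solution, since inequations between maps out of [T (dom r)] may be
    tested on finite tuples.  That the extension fills the original cylinder is first
    known for tuples factoring through a leg only, and general tuples are reached
    because the legs are jointly epimorphic on powers. *)
Theorem universal_fillable :
  universal T c ->
  (forall i : index S, fillable T (obj i)) ->
  (forall r : rel S, generated T (dom r)) ->
  fillable T C.
Proof.
intros [Ex _] Fi Ge D phi.
assert (Hg : forall i, exists g : Hom (T (obj i)) D,
    forall (n : FinSet) (h : Hom (discrete V n) (obj i)) t,
      cyl_app phi (hom_comp (c i) h) t = g (act T h t))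
  by (intros i; exact (Fi i D (cyl_restrict (c i) phi))).
pose (g := fun i => proj1_sig (constructive_indefinite_description _ (Hg i))).
assert (Eg : forall i (n : FinSet) (h : Hom (discrete V n) (obj i)) t,
    cyl_app phi (hom_comp (c i) h) t = g i (act T h t))
  by (intros i; exact (proj2_sig (constructive_indefinite_description _ (Hg i)))).
clearbody g; clear Hg.
destruct (Ex D g) as [u Hu].
{ intros r; apply (Ge r D (hom_comp (g _) (act T (lmap r))) (hom_comp (g _) (act T (rmap r)))).
  intros n h t; simpl fn.
  refine (le_eq (f_equal (g _) (eq_sym (act_comp T (lmap r) h t)))
                (f_equal (g _) (eq_sym (act_comp T (rmap r) h t))) _).
  refine (le_eq (eq_sym (Eg _ n _ t)) (eq_sym (Eg _ n _ t)) _).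
  apply (hom_mono (cyl_at phi n)); intros a; exact (csol (h a)). }
exists u; intros n h t.
apply (universal_eq (cpow n) (u := cyl_value phi t) (v := act_value u t)).
intros i k.
refine (eq_trans (Eg i n k t) (eq_trans (eq_sym (Hu i _)) _)).
apply (f_equal u), eq_sym, (act_comp T (c i) (k : Hom (discrete V n) _)).
Qed.

Theorem universal_generated :
  universal T c -> (forall i : index S, generated T (obj i)) -> generated T C.
Proof.
intros [_ Epi] Ge D u v H; apply Epi; intros i.
apply (Ge i D (hom_comp u (act T (c i))) (hom_comp v (act T (c i)))); intros n h t.
simpl fn; exact (le_eq (f_equal u (eq_sym (act_comp T (c i) h t)))
  (f_equal v (eq_sym (act_comp T (c i) h t))) (H n (hom_comp (c i) h) t)).
Qed.

End Transfer.

(** * Finite posets *)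

(** Over a finite poset every admissible join is a maximum, so V imposes nothing
    beyond monotonicity. *)
Lemma finite_max (V : base) (X : Poset) (S : X -> Prop) :
  Finite X -> admissible V S -> exists m, S m /\ forall x, S x -> x ⊑ m.
Proof.
intros [l Hl] HS; destruct (admissible_directed HS) as [[x0 H0] Hd].
assert (H : exists m, S m /\ forall x, In x l -> S x -> x ⊑ m).
{ clear Hl; induction l as [|a l [m [Hm IH]]].
  - exists x0; split; [assumption | intros x []].
  - destruct (classic (S a)) as [Ha|Ha].
    + destruct (Hd m a Hm Ha) as [z [Hz [L1 L2]]]; exists z; split; [assumption |].
      intros x [<- | Hx] Sx; [assumption | exact (le_trans (IH x Hx Sx) L1)].
    + exists m; split; [assumption |]; intros x [<- | Hx] Sx; [contradiction | auto]. }
destruct H as [m [Hm H]]; exists m; split; [assumption |]; intros x; apply H, Hl.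
Qed.

Lemma finite_joins (V : base) (X : Poset) (S : X -> Prop) :
  Finite X -> admissible V S -> exists s, is_join S s.
Proof.
intros HX HS; destruct (finite_max HX HS) as [m [Hm L]]; exists m; split; auto.
Qed.

Lemma finite_continuous (V : base) (X Y : Poset) (f : X -> Y) :
  Finite X -> monotone f -> continuous V f.
Proof.
intros HX Hf; split; [assumption |]; intros S s HS [U L]; split.
- intros y [x [Hx ->]]; now apply Hf, U.
- intros y Hy; destruct (finite_max HX HS) as [m [Hm Lm]].
  apply le_trans with (f m); [now apply Hf, L | apply Hy; now exists m].
Qed.

Definition finite_obj (V : base) (X : Poset) (HX : Finite X) : Obj V :=
  {| poset := X; has_joins := fun S => @finite_joins V X S HX |}.

Definition finite_map (V : base) (X : Poset) (HX : Finite X) (Y : Obj V) (f : X -> Y)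
    (Hf : monotone f) : Hom (finite_obj V HX) Y :=
  {| fn := f : finite_obj V HX -> Y; fn_continuous := finite_continuous V HX Hf |}.

(** * Order reflection from uniqueness *)

Lemma implb_order : Relation_Definitions.order bool (fun a b => implb a b = true).
Proof.
split; red; [now intros [] | now intros [] [] [] | now intros [] []].
Qed.

Definition two_poset : Poset :=
  {| carrier := bool; le := _; le_order := implb_order |}.

Lemma two_finite : Finite two_poset.
Proof. exists (true :: false :: nil); intros []; simpl; auto. Qed.

Definition two (V : base) : Obj V := finite_obj V two_finite.

(** The pair u <= v as a single map into the power of D by the two-element chain. *)
Section Arrow.
Variables (V : base) (Z D : Obj V) (u v : Hom Z D).
Hypothesis uv : forall z, u z ⊑ v z.

Lemma arrow_monotone z :
  monotone (fun b : two_poset => if b then v z else u z).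
Proof. intros [] [] H; try apply le_refl; [discriminate | apply uv]. Qed.

Definition arrow : Hom Z (exp (two V) D).
Proof.
refine (to_exp (f := fun z => finite_map two_finite (arrow_monotone z)
                       : exp (two V) D) _).
intros []; apply fn_continuous.
Defined.
End Arrow.

(** Order reflection is automatic for colimits given by plain unique existence,
    because V has powers by the two-element chain: if u <= v holds on the legs, these
    inequalities form a solution with values in that power of D, and the map it
    induces has u and v as its endpoints. *)
Lemma unique_universal (V : base) (F : Endofunctor V) (S : System V) (C : Obj V)
    (c : forall i : index S, Hom (obj i) C) :
  solution c ->
  (forall (D : Obj V) (g : forall i : index S, Hom (F (obj i)) D), satisfies g ->
     exists! u : Hom (F C) D, forall i x, u (act F (c i) x) = g i x) ->
  universal F c.
Proof.
intros csol H; split.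
- intros D g Hg; destruct (H D g Hg) as [u [Hu _]]; now exists u.
- intros D u v uv.
  pose (g := fun i => arrow (u := hom_comp u (act F (c i)))
                            (v := hom_comp v (act F (c i))) (uv i)).
  destruct (H _ g) as [w [Hw _]].
  { intros r y [].
    - exact (act_solution v csol y).
    - exact (act_solution u csol y). }
  assert (U : forall u' : Hom (F C) D, forall b : two V,
     (forall i x, u' (act F (c i) x) = fn (g i x : Hom _ D) b) ->
     forall t, u' t = fn (w t : Hom (two V) D) b).
  { intros u' b E t.
    destruct (H D (fun i => hom_comp u' (act F (c i))) (act_solution u' csol))
      as [k [_ Uk]].
    rewrite <- (Uk u' (fun _ _ => eq_refl)).
    apply (f_equal (fun h => fn h t) (Uk (hom_comp (eval_at D b) w)
      (fun i x => eq_trans (f_equal (fun h : Hom (two V) D => h b) (Hw i x))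
                           (eq_sym (E i x))))). }
  intros t; rewrite (U u false), (U v true); try (intros; reflexivity).
  now apply (hom_mono (w t : Hom (two V) D)).
Qed.

(** * Directed diagrams *)

Section Directed.
Variables (V : base) (D : Poset) (X : Diagram V D).

(** Naturality of a cocone is the equation c_j . X(p) = c_i for each p : i <= j; the
    boolean selects one of the two inequations that it amounts to. *)
Definition diagram_system : System V.
Proof.
refine (@Build_System V D X ({e : D * D | fst e ⊑ snd e} * bool)
  (fun r => X (fst (proj1_sig (fst r))))
  (fun r => if snd r then snd (proj1_sig (fst r)) else fst (proj1_sig (fst r)))
  (fun r => if snd r then fst (proj1_sig (fst r)) else snd (proj1_sig (fst r)))
  _ _); intros [[e p] []]; simpl; first [exact (dmap X p) | exact (hom_id _)].
Defined.

Lemma diagram_satisfies (F : Endofunctor V) (C : Obj V)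
    (g : forall i : D, Hom (F (X i)) C) :
  satisfies (S := diagram_system) g <->
  forall i j (p : i ⊑ j) x, g j (act F (dmap X p) x) = g i x.
Proof.
split.
- intros H i j p x.
  pose (e := exist (fun e : D * D => fst e ⊑ snd e) (i, j) p).
  apply le_antisym.
  + refine (le_eq eq_refl _ (H (e, true) x)); simpl; now rewrite act_id.
  + refine (le_eq _ eq_refl (H (e, false) x)); simpl; now rewrite act_id.
- intros H [[[i j] p] []] x; simpl in *; rewrite act_id, H; apply le_refl.
Qed.

Lemma diagram_solution (C : Obj V) (c : Cocone X C) : solution (S := diagram_system) c.
Proof.
intros [[[i j] p] []] x; simpl in *;
  rewrite <- (leg_natural c p); apply le_refl.
Qed.

Section Sifted.
Hypothesis HD : directed_poset D.

Lemma upper_bound (i j : D) : exists k, i ⊑ k /\ j ⊑ k.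
Proof. destruct (proj2 HD i j I I) as [k [_ H]]; now exists k. Qed.

Lemma diagram_bounded : bounded diagram_system.
Proof.
intros i j; destruct (upper_bound i j) as [k [p q]].
exists k, (dmap X p), (dmap X q); intros F C g Hg.
pose proof (proj1 (diagram_satisfies g) Hg) as E; split; apply E.
Qed.

Lemma dmap_trans (i j k : D) (p : i ⊑ j) (q : j ⊑ k) (r : i ⊑ k) x :
  fn (dmap X r : Hom _ _) x = fn (dmap X q : Hom _ _) (fn (dmap X p : Hom _ _) x).
Proof. now rewrite (dmap_comp X p q r). Qed.

(** [G i j x h] is g at any upper bound of i and j, applied to the images of x and h
    there; directedness makes the value independent of the bound, and both solution
    properties follow by evaluating at a bound of the larger indices. *)
Lemma diagram_separable : separable diagram_system.
Proof.
intros A C g Hg; pose proof (proj1 (diagram_satisfies g) Hg) as E; clear Hg.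
pose (ub := fun i j => constructive_indefinite_description _ (upper_bound i j)).
pose (G := fun i j => let (k, H) := ub i j in
   curry_prepend (g k) (dmap X (proj1 H)) (act (pow V A) (dmap X (proj2 H)))).
assert (HG : forall i j k (p : i ⊑ k) (q : j ⊑ k) x h,
   fn (G i j x : Hom (pow V A (X j)) C) h
   = g k (prepend (fn (dmap X p : Hom _ _) x) (act (pow V A) (dmap X q) h))).
{ intros i j k p q x h; unfold G; destruct (ub i j) as [k' [p' q']]; simpl proj1; simpl proj2.
  refine (eq_trans (curry_prepend_eq _ _ _ _ _) _).
  destruct (upper_bound k k') as [m [a a']].
  rewrite <- (E _ _ a), <- (E _ _ a').
  apply f_equal, tup_ext; intros [b|].
  - transitivity (fn (dmap X (le_trans q a) : Hom _ _) (proj _ b h)).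
    + symmetry; apply dmap_trans.
    + apply dmap_trans.
  - transitivity (fn (dmap X (le_trans p a) : Hom _ _) x).
    + symmetry; apply dmap_trans.
    + apply dmap_trans. }
exists G; repeat split.
- intros i x h; rewrite (HG i i i (le_refl i) (le_refl i)).
  apply (f_equal (g i)), tup_ext; intros [a|]; simpl; now rewrite dmap_id.
- assert (E1 : forall i i' (p : i ⊑ i') j x h,
     fn (G i' j (fn (dmap X p : Hom _ _) x) : Hom (pow V A (X j)) C) h
     = fn (G i j x : Hom (pow V A (X j)) C) h).
  { intros i i' p j x h; destruct (upper_bound i' j) as [k [a b]].
    rewrite (HG _ _ k a b), (HG _ _ k (le_trans p a) b).
    f_equal; f_equal; symmetry; apply dmap_trans. }
  intros [[[i i'] p] []] j x h; simpl in *; rewrite E1; apply le_refl.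
- assert (E1 : forall i j j' (p : j ⊑ j') x h,
     fn (G i j' x : Hom (pow V A (X j')) C) (act (pow V A) (dmap X p) h)
     = fn (G i j x : Hom (pow V A (X j)) C) h).
  { intros i j j' p x h; destruct (upper_bound i j') as [k [a b]].
    rewrite (HG _ _ k a b), (HG _ _ k a (le_trans p b)).
    f_equal; f_equal; apply tup_ext; intros m; symmetry; apply dmap_trans. }
  intros i [[[j j'] p] []] x h; simpl lindex; simpl rindex; simpl lmap; simpl rmap.
  + refine (le_eq (E1 _ _ _ p _ _) (f_equal (fn (G i j x : Hom (pow V A (X j)) C)) _) (le_refl _)).
    apply act_id.
  + refine (le_eq (f_equal (fn (G i j x : Hom (pow V A (X j)) C)) _) (E1 _ _ _ p _ _) (le_refl _)).
    apply act_id.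
Qed.

Lemma diagram_sifted : sifted diagram_system.
Proof.
destruct (proj1 HD) as [i _].
split; [exact (inhabits i) | exact (conj diagram_bounded diagram_separable)].
Qed.

End Sifted.

Section Colimits.
Variables (C : Obj V) (c : Cocone X C).

Lemma colimit_universal : is_colimit c ->
  universal (id_functor V) (c : forall i : index diagram_system, Hom (obj i) C).
Proof.
intros H; apply unique_universal; [apply diagram_solution |]; intros E g Hg.
pose proof (proj1 (diagram_satisfies g) Hg) as N.
destruct (H E (@Build_Cocone V D X E g
   (fun i j p => hom_ext (f := hom_comp (g j) (dmap X p)) (N i j p)))) as [u [Hu Uu]].
exists u; split.
- intros i x; exact (f_equal (fun h : Hom (X i) E => h x) (Hu i)).
- intros v Hv; apply Uu; intros i; apply hom_ext; exact (Hv i).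
Qed.

Lemma map_colimit_universal (F : Endofunctor V) : is_colimit (map_cocone F c) <->
  universal F (c : forall i : index diagram_system, Hom (obj i) C).
Proof.
split.
- intros H; apply unique_universal; [apply diagram_solution |]; intros E g Hg.
  pose proof (proj1 (diagram_satisfies g) Hg) as N.
  destruct (H E (@Build_Cocone V D (map_diagram F X) E g
     (fun i j p => hom_ext (f := hom_comp (g j) (act F (dmap X p))) (N i j p))))
    as [u [Hu Uu]].
  exists u; split.
  + intros i x; exact (f_equal (fun h : Hom (F (X i)) E => h x) (Hu i)).
  + intros v Hv; apply Uu; intros i; apply hom_ext; exact (Hv i).
- intros H E e.
  destruct (proj1 H E e) as [u Hu].
  { apply diagram_satisfies; intros i j p x.
    exact (f_equal (fun h : Hom (F (X i)) E => h x) (leg_natural e p)). }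
  exists u; split.
  + intros i; apply hom_ext; exact (Hu i).
  + intros v Hv; apply hom_ext; apply (universal_eq H); intros i x; rewrite Hu.
    symmetry; exact (f_equal (fun h : Hom (F (X i)) E => h x) (Hv i)).
Qed.

End Colimits.
End Directed.

(** * Coinserters *)

Section CoinserterSystem.
Variables (V : base) (A B : Obj V) (f0 f1 : Hom A B).

Definition pair_system : System V :=
  @Build_System V unit (fun _ => B) unit (fun _ => A) (fun _ => tt) (fun _ => tt)
    (fun _ => f0) (fun _ => f1).

Lemma coinserter_universal (F : Endofunctor V) (C : Obj V) (c : Hom B C) :
  solution (S := pair_system) (fun _ => c) ->
  (is_coinserter (V := V) (act F f0) (act F f1) (act F c) <->
   universal (S := pair_system) F (fun _ => c)).
Proof.
intros csol; split.
- intros [_ [Ex Epi]]; split.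
  + intros D g Hg; destruct (Ex D (g tt)) as [u Hu].
    * exact (Hg tt).
    * exists u; intros [] x; exact (f_equal (fun h : Hom (F B) D => h x) Hu).
  + intros D u v H; exact (Epi D u v (H tt)).
- intros [Ex Epi]; split; [| split].
  + intros y; exact (act_solution (F := F) (hom_id _) csol (r := tt) y).
  + intros D g Hg; destruct (Ex D (fun _ => g)) as [u Hu].
    * intros []; exact Hg.
    * exists u; apply hom_ext; exact (Hu tt).
  + intros D u v H; exact (Epi D u v (fun _ => H)).
Qed.

(** The two-variable family is g itself.  Given the common section d, an inequation
    in one coordinate is an instance of the inequation in all coordinates, with the
    other coordinates moved into A by d. *)
Lemma pair_sifted : reflexive_pair (V := V) f0 f1 -> sifted pair_system.
Proof.
intros [d [d0 d1]].
assert (E0 : forall x, f0 (fn d x) = x)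
  by (intros x; exact (f_equal (fun h : Hom B B => h x) d0)).
assert (E1 : forall x, f1 (fn d x) = x)
  by (intros x; exact (f_equal (fun h : Hom B B => h x) d1)).
split; [exact (inhabits tt) | split].
- intros [] []; exists tt, (hom_id B), (hom_id B); intros F D g Hg; split;
    intros x; now rewrite act_id.
- intros P D g Hg.
  exists (fun _ _ => curry_prepend (g tt) (hom_id B) (hom_id (pow V P B))).
  assert (E : forall x (h : pow V P B),
    fn (curry_prepend (g tt) (hom_id B) (hom_id (pow V P B)) x : Hom (pow V P B) D) h
    = g tt (prepend x h)).
  { intros x h; apply (curry_prepend_eq (g tt) (hom_id B) (hom_id (pow V P B))). }
  repeat split.
  + intros []; exact E.
  + intros [] [] y h; refine (le_eq (E _ _) (E _ _) _).
    refine (le_eq _ _ (Hg tt (prepend y (act (pow V P) d h)))); apply (f_equal (g tt)).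
    * apply tup_ext; intros [p|]; [symmetry; apply E0 | reflexivity].
    * apply tup_ext; intros [p|]; [symmetry; apply E1 | reflexivity].
  + intros [] [] x h; refine (le_eq (E _ _) (E _ _) _).
    refine (le_eq _ _ (Hg tt (prepend (fn d x) h))); apply (f_equal (g tt)).
    * apply tup_ext; intros [p|]; [reflexivity | symmetry; apply E0].
    * apply tup_ext; intros [p|]; [reflexivity | symmetry; apply E1].
Qed.

End CoinserterSystem.

(** * Subposets *)

Section Subposet.
Variables (X : Poset) (R : X -> Prop).

Lemma sub_order :
  Relation_Definitions.order {x : X | R x} (fun a b => proj1_sig a ⊑ proj1_sig b).
Proof.
split.
- intros a; apply le_refl.
- intros a b c; apply le_trans.
- intros [a Ha] [b Hb] H1 H2; simpl in *.
  destruct (le_antisym H1 H2); now rewrite (proof_irrelevance _ Ha Hb).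
Qed.

Definition sub_poset : Poset :=
  {| carrier := {x : X | R x}; le := _; le_order := sub_order |}.

(** Admissibility is internal to any subposet that contains the subset, whether or
    not that subposet is closed under joins. *)
Lemma admissible_sub (V : base) (S : X -> Prop) :
  (forall x, S x -> R x) -> admissible V S ->
  admissible V (fun a : sub_poset => S (proj1_sig a)).
Proof.
intros HR; destruct V; simpl.
- tauto.
- intros [u [Hu HS]].
  assert (Su : forall n, S (u n)) by (intros n; apply HS; now exists n).
  exists (fun n => exist R (u n) (HR _ (Su n))); split; [exact Hu |].
  intros [x Hx]; simpl; rewrite HS; split; intros [n E]; exists n.
  + subst x; now rewrite (proof_irrelevance _ Hx (HR _ (Su n))).
  + exact (f_equal (@proj1_sig _ _) E).
- intros [[x Hx] Hd]; split; [now exists (exist R x (HR x Hx)) |].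
  intros [a Ra] [b Rb] Ha Hb; destruct (Hd a b Ha Hb) as [z [Hz L]].
  now exists (exist R z (HR z Hz)).
Qed.

Lemma finite_sub : (exists l : list X, forall x, R x -> In x l) -> Finite sub_poset.
Proof.
intros [l Hl].
exists (flat_map (fun x => match excluded_middle_informative (R x) with
                           | left H => exist R x H :: nil
                           | right _ => nil end) l).
intros [x Hx]; apply in_flat_map; exists x; split; [auto |].
destruct (excluded_middle_informative (R x)) as [H|H]; [left | contradiction].
now rewrite (proof_irrelevance _ H Hx).
Qed.

End Subposet.

Lemma pred_order (A : Type) :
  Relation_Definitions.order (A -> Prop) (fun I J => forall a, I a -> J a).
Proof.
split; red; auto.
intros I J H1 H2; extensionality a; apply propositional_extensionality; split; auto.
Qed.

Definition pred_poset (A : Type) : Poset :=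
  {| carrier := A -> Prop; le := _; le_order := pred_order A |}.

Section Comma.
Variables (B : Poset) (X : Poset) (c : B -> X).

Lemma prod_order :
  Relation_Definitions.order (B * B) (fun a b => fst a ⊑ fst b /\ snd a ⊑ snd b).
Proof.
split.
- intros a; split; apply le_refl.
- intros x y z [H1 H2] [H3 H4]; split; eapply le_trans; eassumption.
- intros [x1 x2] [y1 y2] [H1 H2] [H3 H4]; f_equal; now apply le_antisym.
Qed.

Definition comma_poset : Poset :=
  sub_poset (X := {| carrier := B * B; le := _; le_order := prod_order |})
    (fun p => c (fst p) ⊑ c (snd p)).
End Comma.

(** * The free object on a poset *)

Section Free.
Variables (V : base) (P : Poset).

(** The least family of down-sets containing the principal ones and closed under
    admissible unions.  It consists of the principal ideals for Pos, of the ideals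
    generated by omega-chains for CPO, and of all ideals for DCPO. *)
Inductive ideal : pred_poset P -> Prop :=
| principal p : ideal (fun q => q ⊑ p)
| union (S : pred_poset P -> Prop) : (forall I, S I -> ideal I) -> admissible V S ->
    ideal (fun q => exists I, S I /\ I q).

Definition ideal_poset : Poset := sub_poset ideal.

Lemma union_join (S : ideal_poset -> Prop) (s : ideal_poset) :
  (forall q, proj1_sig s q <-> exists I, S I /\ proj1_sig I q) -> is_join S s.
Proof.
intros H; split.
- intros I HI q Hq; apply H; now exists I.
- intros J HJ q Hq; apply H in Hq; destruct Hq as [I [HI Hq]]; exact (HJ I HI q Hq).
Qed.

Lemma ideal_joins (S : ideal_poset -> Prop) : admissible V S ->
  exists s : ideal_poset, forall q, proj1_sig s q <-> exists I, S I /\ proj1_sig I q.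
Proof.
intros HS.
assert (M : monotone (X := ideal_poset) (Y := pred_poset P) (@proj1_sig _ _))
  by (intros I J H; exact H).
pose proof (admissible_image M HS) as HS'.
assert (Hid : forall I, image (@proj1_sig _ _) S I -> ideal I)
  by (intros I [[J HJ] [_ ->]]; exact HJ).
exists (exist _ _ (union Hid HS')); intros q; simpl; split.
- intros [I [[J [HJ ->]] Hq]]; now exists J.
- intros [J [HJ Hq]]; exists (proj1_sig J); split; [now exists J | assumption].
Qed.

Definition free : Obj V.
Proof.
refine {| poset := ideal_poset |}; intros S HS.
destruct (ideal_joins HS) as [s Hs]; exists s; exact (union_join Hs).
Defined.

Lemma free_join (S : free -> Prop) (s : free) : admissible V S -> is_join S s ->
  forall q, proj1_sig s q <-> exists I, S I /\ proj1_sig I q.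
Proof.
intros HS Hs; destruct (ideal_joins HS) as [t Ht].
now rewrite (join_unique Hs (union_join Ht)).
Qed.

Definition unit_map (p : P) : free := exist _ _ (principal p).

Lemma unit_monotone : monotone unit_map.
Proof. intros p p' H q Hq; exact (le_trans Hq H). Qed.

Lemma free_reflects (D : Obj V) (g g' : Hom free D) :
  (forall p, g (unit_map p) ⊑ g' (unit_map p)) -> forall I, g I ⊑ g' I.
Proof.
intros H [I HI]; assert (J := HI); revert HI.
induction J as [p | S HS IH Adm]; intros HI.
- rewrite (proof_irrelevance _ HI (principal p)); apply H.
- set (s := exist _ _ _ : free).
  pose (S' := fun I : free => S (proj1_sig I)).
  assert (Adm' : admissible V S') by exact (admissible_sub HS Adm).
  assert (Hs : is_join S' s).
  { apply union_join; intros q; simpl; split; intros [I [SI Hq]].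
    - now exists (exist _ I (HS I SI)).
    - now exists (proj1_sig I). }
  apply (proj2 (proj2 (fn_continuous g) S' s Adm' Hs)).
  intros d [[I HI'] [SI ->]]; apply le_trans with (g' (exist _ I HI')).
  + exact (IH I SI HI').
  + apply hom_mono, (proj1 Hs); exact SI.
Qed.

Section Extend.
Variables (D : Obj V) (f : P -> D).
Hypothesis Hf : monotone f.

(** The extension of f sends an ideal to the join of its image under f.  The ideals
    for which this join exists form a subposet, on which taking the join is monotone,
    so that admissible families are carried to admissible subsets of D; this is what
    the induction over ideals requires. *)
Definition has_image_join (I : pred_poset P) : Prop := exists d, is_join (image f I) d.

Definition image_join (I : sub_poset has_image_join) : D :=
  proj1_sig (constructive_indefinite_description _ (proj2_sig I)).

Lemma image_joinP I : is_join (image f (proj1_sig I)) (image_join I).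
Proof. apply (proj2_sig (constructive_indefinite_description _ (proj2_sig I))). Qed.

Lemma image_join_monotone : monotone image_join.
Proof.
intros I J H; apply (proj2 (image_joinP I)); intros d [p [Hp ->]].
apply (proj1 (image_joinP J)); exists p; split; [exact (H p Hp) | reflexivity].
Qed.

Lemma ideal_image_join (I : pred_poset P) : ideal I -> has_image_join I.
Proof.
induction 1 as [p | S HS IH Adm].
- exists (f p); split.
  + intros d [q [Hq ->]]; now apply Hf.
  + intros d Hd; apply Hd; exists p; split; [apply le_refl | reflexivity].
- destruct (has_joins (admissible_image image_join_monotone (admissible_sub IH Adm)))
    as [d [Ud Ld]].
  exists d; split.
  + intros e [q [[I [HI Hq]] ->]].
    apply le_trans with (image_join (exist _ I (IH I HI))).
    * apply (proj1 (image_joinP (exist _ I (IH I HI)))); now exists q.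
    * apply Ud; now exists (exist _ I (IH I HI)).
  + intros e He; apply Ld; intros d' [J [HJ ->]].
    apply (proj2 (image_joinP J)); intros e' [q [Hq ->]].
    apply He; exists q; split; auto; now exists (proj1_sig J).
Qed.

Definition extend_fun (I : free) : D :=
  image_join (exist has_image_join (proj1_sig I) (ideal_image_join (proj2_sig I))).

Lemma extend_funP (I : free) : is_join (image f (proj1_sig I)) (extend_fun I).
Proof. apply (image_joinP (exist has_image_join _ _)). Qed.

Lemma extend_continuous : continuous V extend_fun.
Proof.
assert (M : monotone extend_fun) by (intros I J H; apply image_join_monotone, H).
split; [exact M |]; intros S s HS Hs; split.
- intros d [I [HI ->]]; apply M, (proj1 Hs), HI.
- intros d Hd; apply (proj2 (extend_funP s)); intros e [q [Hq ->]].
  apply (free_join HS Hs) in Hq; destruct Hq as [I [HI Hq]].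
  apply le_trans with (extend_fun I).
  + apply (proj1 (extend_funP I)); now exists q.
  + apply Hd; now exists I.
Qed.

Definition extend : Hom free D := Build_Hom extend_continuous.

Lemma extend_unit p : extend (unit_map p) = f p.
Proof.
apply le_antisym.
- apply (proj2 (extend_funP (unit_map p))); intros d [q [Hq ->]]; now apply Hf.
- apply (proj1 (extend_funP (unit_map p))); exists p; split; [apply le_refl | reflexivity].
Qed.

End Extend.

Lemma free_eq (D : Obj V) (g g' : Hom free D) :
  (forall p, g (unit_map p) = g' (unit_map p)) -> g = g'.
Proof.
intros H; apply hom_ext; intros I; apply le_antisym; apply free_reflects; intros p;
  rewrite H; apply le_refl.
Qed.

(** ** The free object as a directed colimit *)

Definition finite_subset (F : pred_poset P) : Prop :=
  exists l : list P, forall p, F p -> In p l.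

Definition subsets : Poset := sub_poset finite_subset.

Lemma subsets_directed : directed_poset subsets.
Proof.
split.
- unshelve eexists (exist _ (fun _ => False) _); [| trivial].
  now exists nil.
- intros [F [l Hl]] [G [m Hm]] _ _.
  unshelve eexists (exist _ (fun p => F p \/ G p) _).
  + exists (l ++ m); intros p [Hp|Hp]; apply in_or_app; auto.
  + split; [trivial |]; split; intros p Hp; simpl; auto.
Qed.

Definition subset_poset (F : subsets) : Poset := sub_poset (proj1_sig F).

Definition subset_finite (F : subsets) : Finite (subset_poset F) :=
  finite_sub (proj2_sig F).

Lemma inclusion_monotone (F G : subsets) (H : F ⊑ G) :
  monotone (fun a : subset_poset F =>
              exist (proj1_sig G) (proj1_sig a) (H _ (proj2_sig a)) : subset_poset G).
Proof. intros a b L; exact L. Qed.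

Definition subset_diagram : Diagram V subsets.
Proof.
refine (@Build_Diagram V subsets
  (fun F => finite_obj V (subset_finite F))
  (fun F G H => finite_map (Y := finite_obj V (subset_finite G))
                  (subset_finite F) (inclusion_monotone H)) _ _).
- intros F H; apply hom_ext; intros [p Hp]; simpl; f_equal; apply proof_irrelevance.
- intros F G E p q r; apply hom_ext; intros [x Hx]; simpl; f_equal; apply proof_irrelevance.
Defined.

Lemma unit_leg_monotone (F : subsets) :
  monotone (fun a : subset_poset F => unit_map (proj1_sig a)).
Proof. intros a b L; exact (unit_monotone L). Qed.

Definition free_cocone : Cocone subset_diagram free.
Proof.
refine (@Build_Cocone V subsets subset_diagram free
  (fun F => finite_map (Y := free) (subset_finite F) (@unit_leg_monotone F)) _).
now intros F G H; apply hom_ext.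
Defined.

Lemma pair_finite (p q : P) : finite_subset (fun x => x = p \/ x = q).
Proof. exists (p :: q :: nil); intros x [-> | ->]; simpl; auto. Qed.

(** Any two comparable elements of P lie in a common finite subset, so a cocone on the
    finite subposets is the same as a monotone map out of P. *)
Theorem free_colimit : is_colimit free_cocone.
Proof.
intros D c.
pose (pair := fun p q => exist finite_subset _ (pair_finite p q) : subsets).
assert (N : forall (F G : subsets) p (Hp : proj1_sig F p) (Hq : proj1_sig G p),
  F ⊑ G -> fn (c F : Hom _ _) (exist _ p Hp) = fn (c G : Hom _ _) (exist _ p Hq)).
{ intros F G p Hp Hq H.
  rewrite <- (leg_natural c H); simpl; f_equal; f_equal; apply proof_irrelevance. }
pose (f := fun p => fn (c (pair p p) : Hom _ _) (exist _ p (or_introl eq_refl))).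
assert (E : forall F p Hp, fn (c F : Hom _ _) (exist _ p Hp) = f p).
{ intros F p Hp; symmetry; apply N; now intros x [-> | ->]. }
assert (Mf : monotone f).
{ intros p q L.
  rewrite <- (E (pair p q) p (or_introl eq_refl)), <- (E (pair p q) q (or_intror eq_refl)).
  apply hom_mono; exact L. }
exists (extend Mf); split.
- intros F; apply hom_ext; intros [p Hp]; exact (eq_trans (extend_unit Mf p) (eq_sym (E F p Hp))).
- intros u Hu; apply free_eq; intros p; refine (eq_trans (extend_unit Mf p) _).
  exact (f_equal (fun h : Hom (subset_diagram (pair p p)) D =>
                    h (exist _ p (or_introl eq_refl))) (eq_sym (Hu (pair p p)))).
Qed.

End Free.

(** * Every object is reached from the finite discrete ones *)

Section Reach.
Variables (V : base) (T : Endofunctor V).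

Definition kan_at (x : Obj V) : Prop := fillable T x /\ generated T x.

Lemma kan_at_colimit (D : Poset) (X : Diagram V D) (C : Obj V) (c : Cocone X C) :
  preserves_directed_colimits T -> directed_poset D -> is_colimit c ->
  (forall i, kan_at (X i)) -> kan_at C.
Proof.
intros HT HD Hc HX.
pose proof (proj1 (map_colimit_universal c T) (HT D X C c HD Hc)) as U.
pose proof (fun n : FinSet => power_universal (diagram_sifted X HD) (diagram_solution c)
  (colimit_universal Hc) (elt_finite n)) as Pw.
split.
- apply (universal_fillable (diagram_solution c) Pw U).
  + intros i; apply HX.
  + intros [[[i j] p] b]; apply HX.
- apply (universal_generated U); intros i; apply HX.
Qed.

Lemma kan_at_coinserter (A B C : Obj V) (f0 f1 : Hom A B) (c : Hom B C) :
  preserves_reflexive_surjective_coinserters T ->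
  reflexive_pair (V := V) f0 f1 -> is_coinserter (V := V) f0 f1 c ->
  surjective (V := V) c ->
  kan_at A -> kan_at B -> kan_at C.
Proof.
intros HT Hr Hc Hs [_ GA] [FB GB].
assert (sol : solution (S := pair_system f0 f1) (fun _ => c)) by (intros r; exact (proj1 Hc)).
pose proof (proj1 (coinserter_universal T sol) (HT A B C f0 f1 c Hr Hc Hs)) as U.
pose proof (fun n : FinSet => power_universal (pair_sifted Hr) sol
  (proj1 (coinserter_universal (id_functor V) sol) Hc) (elt_finite n)) as Pw.
split.
- exact (universal_fillable sol Pw U (fun _ => FB) (fun _ => GA)).
- exact (universal_generated U (fun _ => GB)).
Qed.

Hypotheses (HD : preserves_directed_colimits T)
  (HC : preserves_reflexive_surjective_coinserters T).

Lemma kan_at_discrete (A : Type) : Finite A -> kan_at (discrete V A).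
Proof.
intros HA; pose (n := {| elt := A; elt_finite := HA |}).
exact (conj (@fillable_finite V T n) (@generated_finite V T n)).
Qed.

Lemma surjective_coinserter (A B C : Obj V) (f0 f1 : Hom A B) (c : Hom B C) :
  (forall a, c (f0 a) ⊑ c (f1 a)) -> surjective (V := V) c ->
  (forall (D : Obj V) (g : Hom B D), (forall a, g (f0 a) ⊑ g (f1 a)) ->
     exists u : Hom C D, forall b, u (c b) = g b) ->
  is_coinserter (V := V) f0 f1 c.
Proof.
intros sol Hs Ex; split; [exact sol | split].
- intros D g Hg; destruct (Ex D g Hg) as [u Hu]; exists u; now apply hom_ext.
- intros D u v H x; destruct (Hs x) as [b <-]; exact (H b).
Qed.

(** The poset X is obtained from its elements by imposing the pairs of its order.
    This presents X in V itself because monotone maps out of a finite poset are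
    continuous. *)
Lemma kan_at_finite (X : Poset) (HX : Finite X) : kan_at (finite_obj V HX).
Proof.
pose (A := {p : X * X | fst p ⊑ snd p}).
assert (HA : Finite A).
{ destruct HX as [l Hl].
  apply (@finite_sub (discrete_poset (X * X))
           (fun p => fst p ⊑ snd p)).
  exists (list_prod l l); intros [x y] _; apply in_prod; apply Hl. }
pose (f0 := from_discrete (fun p : A => fst (proj1_sig p) : discrete V X)).
pose (f1 := from_discrete (fun p : A => snd (proj1_sig p) : discrete V X)).
pose (c := from_discrete (fun x : X => x : finite_obj V HX)).
apply (@kan_at_coinserter (discrete V A) (discrete V X) _ f0 f1 c HC).
- exists (from_discrete (fun x : X => exist _ (x, x) (le_refl x) : discrete V A)).
  split; now apply hom_ext.
- apply surjective_coinserter.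
  + intros [p Hp]; exact Hp.
  + intros x; now exists x.
  + intros D g Hg.
    assert (M : monotone (X := X) (fn g))
      by (intros x y L; exact (Hg (exist _ (x, y) L))).
    now exists (finite_map HX M).
- intros x; now exists x.
- now apply kan_at_discrete.
- now apply kan_at_discrete.
Qed.

Lemma kan_at_free (P : Poset) : kan_at (free V P).
Proof.
apply (kan_at_colimit HD (subsets_directed P) (free_colimit (V := V) (P := P))).
intros F; apply kan_at_finite.
Qed.

(** A map g out of B(x) identifying ideals with the same join is determined by the
    monotone map a |-> g (principal a) on x.  This map is continuous: an admissible
    subset of x with join s is carried by the unit to an admissible subset of B(x)
    whose join I is sent by c to s, and g preserves the join I.  The comparisons
    between ideals are imposed through the free object on their poset Q, which keeps
    the domain of the pair among the objects already reached; the diagonal makes the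
    pair reflexive. *)
Theorem kan_at_all (x : Obj V) : kan_at x.
Proof.
pose (B := free V x).
assert (Mid : monotone (fun a : x => a)) by (intros a b L; exact L).
pose (c := extend Mid : Hom B x).
assert (Ec : forall a, c (unit_map V a) = a) by (intros a; apply extend_unit).
pose (Q := comma_poset (fn c)).
assert (M0 : monotone (fun q : Q => fst (proj1_sig q) : B)) by (intros q r [L _]; exact L).
assert (M1 : monotone (fun q : Q => snd (proj1_sig q) : B)) by (intros q r [_ L]; exact L).
pose (f0 := extend M0 : Hom (free V Q) B).
pose (f1 := extend M1 : Hom (free V Q) B).
assert (sol : forall t, c (f0 t) ⊑ c (f1 t)).
{ apply (free_reflects (g := hom_comp c f0) (g' := hom_comp c f1)); intros q.
  refine (le_eq (f_equal c (extend_unit M0 q)) (f_equal c (extend_unit M1 q)) _).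
  exact (proj2_sig q). }
assert (surj : surjective (V := V) c) by (intros a; now exists (unit_map V a)).
apply (@kan_at_coinserter (free V Q) B x f0 f1 c HC); [| | exact surj | apply kan_at_free | apply kan_at_free].
- pose (diag := fun a : x => exist _ (unit_map V a, unit_map V a) (le_refl _) : Q).
  assert (Md : monotone (fun a : x => unit_map V (diag a))).
  { intros a b L; apply unit_monotone; split; exact (unit_monotone L). }
  exists (extend Md : Hom B (free V Q)); split; apply free_eq; intros a.
  + refine (eq_trans (f_equal f0 (extend_unit Md a)) (extend_unit M0 _)).
  + refine (eq_trans (f_equal f1 (extend_unit Md a)) (extend_unit M1 _)).
- apply surjective_coinserter; auto; intros D g Hg.
  assert (H : forall I J : B, c I ⊑ c J -> g I ⊑ g J).
  { intros I J L; pose (q := exist _ (I, J) L : Q).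
    exact (le_eq (f_equal g (eq_sym (extend_unit M0 q)))
                 (f_equal g (eq_sym (extend_unit M1 q))) (Hg (unit_map V q))). }
  assert (Mg : monotone (fun a : x => g (unit_map V a)))
    by (intros a b L; apply hom_mono, unit_monotone, L).
  assert (Hu : forall I, g (unit_map V (c I)) = g I).
  { intros I; apply le_antisym; apply H; rewrite Ec; apply le_refl. }
  assert (Cg : continuous V (fun a : x => g (unit_map V a))).
  { split; [exact Mg |]; intros S s HS Hs.
    pose proof (admissible_image (unit_monotone (V := V) (P := x)) HS) as HS'.
    destruct (has_joins (o := B) HS') as [I HI].
    assert (EI : c I = s).
    { refine (join_unique (proj2 (fn_continuous c) _ _ HS' HI) _); split.
      - intros a [J [[b [Sb ->]] ->]]; rewrite Ec; now apply (proj1 Hs).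
      - intros a Ha; apply (proj2 Hs); intros b Sb; rewrite <- (Ec b); apply Ha.
        exists (unit_map V b); split; auto; now exists b. }
    rewrite <- EI, Hu; destruct (proj2 (fn_continuous g) _ _ HS' HI) as [U L]; split.
    - intros d [a [Sa ->]]; apply U; exists (unit_map V a); split; auto; now exists a.
    - intros d Hd; apply L; intros e [J [[a [Sa ->]] ->]]; apply Hd; now exists a. }
  exists (Build_Hom Cg); exact Hu.
Qed.

End Reach.

Theorem corollary5p8 (V : base) (T : Endofunctor V) :
  strongly_finitary T <->
  preserves_directed_colimits T /\ preserves_reflexive_surjective_coinserters T.
Proof.
split.
- intros HT; split.
  + intros D X C c HD Hc; apply map_colimit_universal.
    apply (fun H => strongly_finitary_universal H HT); intros n.
    exact (power_universal (diagram_sifted X HD) (diagram_solution c)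
             (colimit_universal Hc) (elt_finite n)).
  + intros A B C f0 f1 c Hr Hc Hs.
    assert (sol : solution (S := pair_system f0 f1) (fun _ => c))
      by (intros r; exact (proj1 Hc)).
    apply (coinserter_universal T sol).
    apply (fun H => strongly_finitary_universal H HT); intros n.
    exact (power_universal (pair_sifted Hr) sol
      (proj1 (coinserter_universal (id_functor V) sol) Hc) (elt_finite n)).
- intros [HD HC]; apply strongly_finitary_pointwise; intros x.
  exact (kan_at_all HD HC x).
Qed.
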